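(* Let $P_0,P_1$ be probability measures on a measurable space $(\mathcal X,\mathcal B_{\mathcal X})$ with $P_1\ll P_0$, $\mathrm{KL}(P_1\|P_0)<\infty$ and $\mathrm{KL}(P_0\|P_1)<\infty$, and work in the i.i.d. model they generate. For every betting sequence and every $\alpha\in(0,1)$, $$\limsup_{t\to\infty}\ -\frac1t\log\bar\gamma_t(\alpha)\ \le\ \mathrm{KL}(P_0\|P_1),$$ and the same holds with $\gamma_t(\alpha)$ in place of $\bar\gamma_t(\alpha)$.
   Context: I.i.d. model: $\Omega=\mathcal X^{\mathbb N}$ with product $\sigma$-algebra and coordinates $X_n$, $\mathcal F_t=\sigma(X_1,\dots,X_t)$ ($\mathcal F_0$ trivial), $\mathbb P_i=P_i^{\otimes\mathbb N}$, $i=0,1$. A betting sequence is a sequence $(E_t)_{t\in\mathbb N}$ of $\mathcal F_t$-measurable $E_t:\Omega\to[0,\infty]$ with $\mathbb E_{\mathbb P_0}[E_t\mid\mathcal F_{t-1}]\le1$ $\mathbb P_0$-a.s.; $W_0=1$, $W_t=\prod_{n\le t}E_n$ (with $0\cdot\infty=0$). $\tau_\alpha:=\inf\{t\in\mathbb N:W_t>\frac1\alpha\}$ ($\inf\emptyset=\infty$), $\gamma_t(\alpha):=\mathbb P_1(W_t\le\frac1\alpha)$, $\bar\gamma_t(\alpha):=\mathbb P_1(\tau_\alpha>t)$. *)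

(* Defs.v *)
From HB Require Import structures.
From mathcomp Require Import all_boot all_order all_algebra.
From mathcomp Require Import all_classical all_reals all_analysis.
From mathcomp Require Import measurable_realfun.

Set Implicit Arguments.
Unset Strict Implicit.
Unset Printing Implicit Defensive.

Import Order.TTheory GRing.Theory Num.Theory.
Import numFieldNormedType.Exports.

Local Open Scope classical_set_scope.
Local Open Scope ring_scope.
Local Open Scope charge_scope.
Local Open Scope ereal_scope.

(* The observation X_{n+1} is the coordinate [w n] of a path [w : nat -> X]. *)
Definition observations d (X : measurableType d) (I : set nat) :
    set (set (nat -> X)) :=
  \bigcup_(n in I) preimage_set_system [set: nat -> X] (fun w => w n) measurable.
Arguments observations {d} X I _.

Definition path_space d (X : measurableType d) :=
  g_sigma_algebraType (observations X [set: nat]).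

(* The path space equipped with the sub-sigma-algebra
   F_t = sigma(X_1, ..., X_t) instead of the full product sigma-algebra. *)
Definition history d (X : measurableType d) (t : nat) :=
  g_sigma_algebraType (observations X `I_t).

(* A measure on the path space is determined by its values on these
   finite-dimensional rectangles, which form a pi-system generating the
   product sigma-algebra. *)
Definition is_iid_product d (X : measurableType d) (R : realType)
    (P : probability X R) (Pr : probability (path_space X) R) : Prop :=
  forall (n : nat) (A : nat -> set X), (forall i, measurable (A i)) ->
    Pr [set w | forall i, (i < n)%N -> A i (w i)] = \prod_(i < n) P (A i).

Definition KL d (X : measurableType d) (R : realType)
    (P Q : probability X R) : \bar R :=
  if pselect (P `<< Q)
  then \int[P]_x lne (('d (charge_of_finite_measure P) '/d Q) x)
  else +oo.

(* [g] is a version of the conditional expectation of the [0, +oo]-valued [f]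
   given F_t under [Pr]; such a version exists even if [f] is not integrable,
   and is unique up to [Pr]-null sets. *)
Definition is_cond_expectation d (X : measurableType d) (R : realType)
    (Pr : probability (path_space X) R) (t : nat)
    (f g : path_space X -> \bar R) : Prop :=
  [/\ measurable_fun [set: history X t] (g : history X t -> \bar R),
      forall w, 0 <= g w
    & forall A : set (history X t), measurable A ->
        \int[Pr]_(w in A) g w = \int[Pr]_(w in A) f w].

(* Betting sequences are indexed from 1: the value [E 0] is never used. *)
Definition betting_sequence d (X : measurableType d) (R : realType)
    (Pr0 : probability (path_space X) R)
    (E : nat -> path_space X -> \bar R) : Prop :=
  forall t : nat,
    [/\ measurable_fun [set: history X t.+1]
          (E t.+1 : history X t.+1 -> \bar R),
        forall w, 0 <= E t.+1 w
      & exists g : path_space X -> \bar R,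
          is_cond_expectation Pr0 t (E t.+1) g /\
          {ae Pr0, forall w, g w <= 1}].

Definition wealth T (R : realType) (E : nat -> T -> \bar R) (t : nat) (w : T) :
    \bar R :=
  \prod_(1 <= n < t.+1) E n w.

Definition stopping_time T (R : realType) (E : nat -> T -> \bar R)
    (alpha : R) (w : T) : \bar R :=
  ereal_inf [set (t%:R)%:E | t in
    [set t : nat | (1 <= t)%N /\ (alpha^-1)%:E < wealth E t w]].

Definition gamma_err d (X : measurableType d) (R : realType)
    (Pr1 : probability (path_space X) R) (E : nat -> path_space X -> \bar R)
    (alpha : R) (t : nat) : \bar R :=
  Pr1 [set w | wealth E t w <= (alpha^-1)%:E].

Definition gamma_bar d (X : measurableType d) (R : realType)
    (Pr1 : probability (path_space X) R) (E : nat -> path_space X -> \bar R)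
    (alpha : R) (t : nat) : \bar R :=
  Pr1 [set w | (t%:R)%:E < stopping_time E alpha w].

(* [lne 0 = -oo], so the rate is [+oo] when [p t = 0]; the value at [t = 0],
   where [0^-1 = 0], does not affect the limit superior. *)
Definition decay_rate (R : realType) (p : nat -> \bar R) : \bar R :=
  limn_esup (fun t : nat => - ((t%:R^-1)%:E * lne (p t))).

(* Main.v *)
(* This is the converse half of Stein's lemma with Ville's inequality in the
   role of the level constraint. Let A_t be the event that the wealth stays
   below 1/alpha up to time t. Ville's inequality gives P_0(A_t) >= 1 - alpha.
   Since KL(P_0||P_1) < oo and P_1 << P_0, the two laws are equivalent and
   dP_1/dP_0 = exp(-Z) with Z integrable under P_0 and E_0[Z] = KL(P_0||P_1).
   Hence P_1(A_t) = E_0[exp(-(Z(X_1) + ... + Z(X_t))); A_t], which is at least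
   exp(-t (KL + e)) P_0(A_t, Z(X_1) + ... + Z(X_t) <= t (KL + e)), and the law
   of large numbers keeps the last probability above (1 - alpha) / 2.
   Only the upper tail of the law of large numbers is needed; it follows from
   a Chernoff bound for the truncation of Z and Markov's inequality for the
   remainder. *)

Require Import Defs.
From HB Require Import structures.
From mathcomp Require Import all_boot all_order all_algebra.
From mathcomp Require Import all_classical all_reals all_analysis.
From mathcomp Require Import measurable_realfun ring lra.

Set Implicit Arguments.
Unset Strict Implicit.
Unset Printing Implicit Defensive.

Import Order.TTheory GRing.Theory Num.Theory.
Import numFieldNormedType.Exports.

Local Open Scope classical_set_scope.
Local Open Scope ring_scope.
Local Open Scope ereal_scope.

(** * Finite histories inside the product sigma-algebra *)

Lemma observationsS d (X : measurableType d) (I J : set nat) :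
  I `<=` J -> observations X I `<=` observations X J.
Proof. by move=> IJ A [i /IJ Ji Ai]; exists i. Qed.

Lemma measurable_historyS d (X : measurableType d) (m n : nat)
    (A : set (nat -> X)) : (m <= n)%N ->
  measurable (A : set (history X m)) -> measurable (A : set (history X n)).
Proof.
move=> mn; apply: sub_sigma_algebra2.
by apply: observationsS => i /= im; exact: leq_trans mn.
Qed.

Lemma measurable_history_path d (X : measurableType d) (n : nat)
    (A : set (nat -> X)) :
  measurable (A : set (history X n)) -> measurable (A : set (path_space X)).
Proof. by apply: sub_sigma_algebra2; exact: observationsS. Qed.

Lemma measurable_fun_historyS d d' (X : measurableType d)
    (Y : measurableType d') (m n : nat) (f : (nat -> X) -> Y) : (m <= n)%N ->
  measurable_fun setT (f : history X m -> Y) ->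
  measurable_fun setT (f : history X n -> Y).
Proof.
move=> mn mf _ B mB; apply: measurable_historyS mn _.
exact: mf measurableT _ mB.
Qed.

Lemma measurable_fun_history_path d d' (X : measurableType d)
    (Y : measurableType d') (n : nat) (f : (nat -> X) -> Y) :
  measurable_fun setT (f : history X n -> Y) ->
  measurable_fun setT (f : path_space X -> Y).
Proof.
move=> mf _ B mB; apply: (@measurable_history_path _ _ n).
exact: mf measurableT _ mB.
Qed.

Lemma measurable_coordinate_history d (X : measurableType d) (i n : nat) :
  (i < n)%N -> measurable_fun setT (fun w : history X n => w i).
Proof.
by move=> lein _ B mB; apply: sub_sigma_algebra; exists i => //; exists B.
Qed.

Lemma measurable_coordinate d (X : measurableType d) (i : nat) :
  measurable_fun setT (fun w : path_space X => w i).
Proof.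
apply: (@measurable_fun_history_path _ _ _ _ i.+1 (fun w => w i)).
exact: measurable_coordinate_history.
Qed.

Lemma measurable_rectangle d (X : measurableType d) (n : nat)
    (A : nat -> set X) : (forall i, measurable (A i)) ->
  measurable ([set w | forall i, (i < n)%N -> A i (w i)] : set (history X n)).
Proof.
move=> mA.
rewrite (_ : [set w | _] = \bigcap_(i in `I_n) (fun w => w i) @^-1` A i) //.
apply: bigcap_measurableType => i lein; rewrite -[X in measurable X]setTI.
exact: (@measurable_coordinate_history _ X i n lein measurableT _ (mA i)).
Qed.

(** * Uniqueness on finite histories, independence and integrals of products *)

(** The rectangles in the first [n] coordinates form a pi-system generating F_n, and since [m1] is
    finite the constant cover by [setT] suffices. Agreement is asked and obtained on F_n only, which
    leaves room for densities that depend on [n]. *)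
Lemma history_measure_unique d (X : measurableType d) (R : realType) (n : nat)
    (m1 m2 : {measure set (path_space X) -> \bar R}) :
  m1 setT < +oo ->
  (forall A : nat -> set X, (forall i, measurable (A i)) ->
    m1 [set w | forall i, (i < n)%N -> A i (w i)] =
    m2 [set w | forall i, (i < n)%N -> A i (w i)]) ->
  forall B : set (history X n), measurable B -> m1 B = m2 B.
Proof.
move=> m1oo m12 B mB.
pose G : set (set (path_space X)) := [set S | exists2 A : nat -> set X,
  (forall i, measurable (A i)) & S = [set w | forall i, (i < n)%N -> A i (w i)]].
have GT : G setT.
  by exists (fun=> setT) => //; apply/esym/seteqP; split.
apply: (@g_sigma_algebra_measure_unique _ _ _ G _ (fun=> setT)) => //.
- move=> _ [A mA ->]; apply: (@measurable_history_path _ _ n).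
  exact: measurable_rectangle.
- by rewrite bigcup_const//; exists 0%N.
- move=> _ _ [A mA ->] [C mC ->]; exists (fun i => A i `&` C i).
    by move=> i; exact: measurableI.
  apply/seteqP; split => w /=.
    by move=> [Aw Cw] i lein; split; [exact: Aw|exact: Cw].
  by move=> ACw; split=> i /ACw[].
- by move=> _ [A mA ->]; exact: m12.
- move: B mB; apply: sub_sigma_algebra2.
  move=> _ [i /= lein [C mC <-]].
  exists (fun j => if j == i then C else setT) => [j|]; first by case: ifP.
  apply/seteqP; split => w /=.
    by move=> [_ Cw] j _; case: eqP => // ->.
  by move=> /(_ i lein); rewrite eqxx.
Qed.

(** As functions of [B], both sides are finite measures, so rectangles suffice; there the extra
    constraint on coordinate [n] produces a rectangle in [n.+1] coordinates. *)
Lemma iid_independence d (X : measurableType d) (R : realType)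
    (P : probability X R) (Pr : probability (path_space X) R) (n : nat)
    (B : set (history X n)) (C : set X) :
  is_iid_product P Pr -> measurable B -> measurable C ->
  Pr (B `&` [set w | C (w n)]) = Pr B * P C.
Proof.
move=> iid mB mC.
have mCn : measurable ([set w | C (w n)] : set (path_space X)).
  rewrite -[X in measurable X]setTI.
  exact: (@measurable_coordinate _ X n measurableT _ mC).
have PC0 : (0 <= fine (P C))%R by exact: fine_ge0.
rewrite muleC -[X in X * _](@fineK _ (P C)); last exact: fin_num_measure.
rewrite -[LHS]/(mrestr Pr mCn B) -[RHS]/(mscale (NngNum PC0) Pr B).
apply: (history_measure_unique (n := n)) => // [|A mA].
  apply: (@le_lt_trans _ _ 1); last exact: ltry.
  by apply: probability_le1; exact: measurableI.
rewrite -[RHS]/((fine (P C))%:E * Pr _) -[LHS]/(Pr (_ `&` _)).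
rewrite fineK; last exact: fin_num_measure.
rewrite iid//.
transitivity (Pr [set w | forall i, (i < n.+1)%N ->
    (if i == n then C else A i) (w i)]).
  congr (Pr _); apply/seteqP; split=> w /=.
    move=> [Aw Cw] i; rewrite ltnS leq_eqVlt => /orP[/eqP ->|lein].
      by rewrite eqxx.
    by rewrite ltn_eqF//; exact: Aw.
  move=> h; split=> [i lein|].
    by have := h i (ltnW lein); rewrite ltn_eqF.
  by have := h n (ltnSn n); rewrite eqxx.
rewrite (iid n.+1 (fun i => if i == n then C else A i)); last first.
  by move=> i; case: ifP.
rewrite big_ord_recr/= eqxx muleC; congr (_ * _).
by apply: eq_bigr => i _; rewrite ltn_eqF.
Qed.

(** By independence the joint law of the past and of coordinate [n] is a product measure, so Tonelli
    splits the integral. Integrability is not at issue, because everything is nonnegative. *)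
Lemma ge0_integral_indep d (X : measurableType d) (R : realType)
    (P : probability X R) (Pr : probability (path_space X) R) (n : nat)
    (g : (nat -> X) -> \bar R) (f : X -> \bar R) :
  is_iid_product P Pr ->
  measurable_fun setT (g : history X n -> \bar R) -> (forall w, 0 <= g w) ->
  measurable_fun setT f -> (forall x, 0 <= f x) ->
  \int[Pr]_w (g w * f (w n)) = (\int[Pr]_w g w) * \int[P]_x f x.
Proof.
move=> iid mg g0 mf f0.
have mid : measurable_fun setT (id : path_space X -> history X n).
  by move=> _ B mB; rewrite setTI; exact: measurable_history_path mB.
(* The identity, seen as a map onto the coarser sigma-algebra F_n: its distribution is the
   restriction of [Pr] to F_n, the first factor of the product law. *)
pose past : {mfun path_space X >-> history X n} :=
  HB.pack (id : path_space X -> history X n) (isMeasurableFun.Build _ _ _ _ _ mid).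
have mpair : measurable_fun setT
    ((fun w => (w, w n)) : path_space X -> (history X n * X)%type).
  by apply/measurable_fun_pairP; split => //; exact: measurable_coordinate.
pose pair : {mfun path_space X >-> (history X n * X)%type} :=
  HB.pack ((fun w => (w, w n)) : path_space X -> (history X n * X)%type)
    (isMeasurableFun.Build _ _ _ _ _ mpair).
pose h (z : history X n * X) := g z.1 * f z.2.
have mh : measurable_fun setT h.
  apply: emeasurable_funM.
    exact: measurableT_comp mg measurable_fst.
  exact: measurableT_comp mf measurable_snd.
have h0 z : 0 <= h z by apply: mule_ge0.
have prodE B : measurable B ->
    (distribution Pr past \x P) B = distribution Pr pair B.
  apply: product_measure_unique => S C mS mC.
  by rewrite /distribution /pushforward/= -(iid_independence iid mS mC).
transitivity (\int[distribution Pr pair]_z h z).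
  by rewrite ge0_integral_pushforward.
transitivity (\int[distribution Pr past \x P]_z h z).
  by apply: eq_measure_integral => B mB _; exact/esym/prodE.
rewrite fubini_tonelli1// /fubini_F/h/=.
under eq_integral do rewrite ge0_integralZl//.
rewrite ge0_integralZr//=; last exact: integral_ge0.
by rewrite ge0_integral_pushforward.
Qed.

Lemma ge0_integral_prod d (X : measurableType d) (R : realType)
    (P : probability X R) (Pr : probability (path_space X) R)
    (f : nat -> X -> \bar R) (n : nat) :
  is_iid_product P Pr ->
  (forall i, measurable_fun setT (f i)) -> (forall i x, 0 <= f i x) ->
  measurable_fun setT
    ((fun w => \prod_(i < n) f i (w i)) : history X n -> \bar R) /\
  \int[Pr]_w (\prod_(i < n) f i (w i)) = \prod_(i < n) \int[P]_x f i x.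
Proof.
move=> iid mf f0; elim: n => [|n [mF IH]].
  split.
    apply: eq_measurable_fun (measurable_cst 1) => w _.
    by rewrite big_ord0.
  under eq_integral do rewrite big_ord0.
  by rewrite big_ord0 integral_cst// mul1e; exact: probability_setT.
split.
  apply: (eq_measurable_fun
    (fun w : history X n.+1 => \prod_(i < n) f i (w i) * f n (w n))).
    by move=> w _; rewrite big_ord_recr.
  apply: emeasurable_funM; first exact: measurable_fun_historyS (leqnSn n) mF.
  apply: (measurableT_comp (mf n)); exact: measurable_coordinate_history.
under eq_integral do rewrite big_ord_recr/=.
rewrite (ge0_integral_indep iid mF) ?IH ?big_ord_recr// => w.
by apply: prode_ge0.
Qed.

(** * Integration against a subnormalized density on a sub-sigma-algebra *)

(* [cvgeZr] does not cover [a = +oo]; monotonicity excludes the limit [0 * oo]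
   of nonzero terms. *)
Lemma cvge_mulr_nondecreasing (R : realType) (u : R^nat) (l a : \bar R) :
  {homo u : m n / (m <= n)%N >-> (m <= n)%R} -> (forall n, (0 <= u n)%R) ->
  0 <= a -> EFin \o u @ \oo --> l -> (u n)%:E * a @[n --> \oo] --> l * a.
Proof.
move=> ndu u0 a0 ul; have [afin|] := boolP (a \is a fin_num).
  exact: cvgeZr.
rewrite ge0_fin_numE// -leNgt leye_eq => /eqP ->.
have [u_eq0|] := pselect (forall n, u n = 0%R).
  have -> : l = 0 by rewrite -(cvg_lim _ ul)//; apply: lim_near_cst => //;
    near=> n; rewrite /= u_eq0.
  by rewrite mul0e; apply: cvg_near_cst; near=> n; rewrite u_eq0 mul0e.
move=> /existsNP[m /eqP um0].
have um : (0 < u m)%R by rewrite lt_neqAle eq_sym um0 u0.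
have un : \forall n \near \oo, 0 < (u n)%:E.
  by exists m => // n /= mn; rewrite lte_fin (lt_le_trans um)// ndu.
rewrite gt0_muley; last first.
  rewrite (@lt_le_trans _ _ (u m)%:E)// (cvge_ge _ ul)//.
  by exists m => // n /= mn; rewrite lee_fin ndu.
by apply: cvg_near_cst; near=> n; rewrite gt0_muley//; near: n.
Unshelve. all: by end_near. Qed.

Import HBNNSimple.

Lemma le_integral_density d d' (T : measurableType d) (S : measurableType d')
    (R : realType) (mu : {measure set T -> \bar R}) (phi : T -> S)
    (f : T -> \bar R) (h : S -> \bar R) :
  measurable_fun setT phi -> measurable_fun setT f -> (forall x, 0 <= f x) ->
  (forall B, measurable B -> \int[mu]_(x in phi @^-1` B) f x <= mu (phi @^-1` B)) ->
  measurable_fun setT h -> (forall y, 0 <= h y) ->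
  \int[mu]_x (h (phi x) * f x) <= \int[mu]_x h (phi x).
Proof.
move=> mphi mf f0 fmu mh h0.
pose h_ := nnsfun_approx measurableT mh.
have ndh y : {homo (fun n => h_ n y) : m n / (m <= n)%N >-> (m <= n)%R}.
  by move=> m n mn; exact/lefP/nd_nnsfun_approx.
have hh y : EFin \o h_^~ y @ \oo --> h y by exact: cvg_nnsfun_approx.
have mhphi n : measurable_fun setT (fun x => (h_ n (phi x))%:E).
  by apply/measurable_EFinP; exact: measurableT_comp.
have -> : \int[mu]_x (h (phi x) * f x) =
    limn (fun n => \int[mu]_x ((h_ n (phi x))%:E * f x)).
  rewrite -monotone_convergence//.
  - apply: eq_integral => x _; apply/esym/cvg_lim => //.
    exact: cvge_mulr_nondecreasing.
  - by move=> n; exact: emeasurable_funM.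
  - by move=> n x _; rewrite mule_ge0// lee_fin.
  - by move=> x _ m n mn; rewrite lee_wpmul2r// lee_fin ndh.
have -> : \int[mu]_x h (phi x) = limn (fun n => \int[mu]_x (h_ n (phi x))%:E).
  rewrite -monotone_convergence//.
  - by apply: eq_integral => x _; apply/esym/cvg_lim => //; exact: hh.
  - by move=> n x _; rewrite lee_fin.
  - by move=> x _ m n mn; rewrite lee_fin ndh.
have mpre n r : measurable (phi @^-1` (h_ n @^-1` [set r])).
  by rewrite -[X in measurable X]setTI; exact: mphi.
have preI n r x :
    \1_(h_ n @^-1` [set r]) (phi x) = \1_(phi @^-1` (h_ n @^-1` [set r])) x :> R.
  by rewrite !indicE.
apply: lee_lim.
- apply: ereal_nondecreasing_is_cvgn => m n mn; apply: ge0_le_integral => //.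
  + by move=> x _; rewrite mule_ge0// lee_fin.
  + exact: emeasurable_funM.
  + exact: emeasurable_funM.
  + by move=> x _; rewrite lee_wpmul2r// lee_fin ndh.
- apply: ereal_nondecreasing_is_cvgn => m n mn; apply: ge0_le_integral => //.
  + by move=> x _; rewrite lee_fin.
  + by move=> x _; rewrite lee_fin ndh.
apply: nearW => n.
have -> : \int[mu]_x ((h_ n (phi x))%:E * f x) =
    \sum_(r \in range (h_ n)) r%:E * \int[mu]_(x in phi @^-1` (h_ n @^-1` [set r])) f x.
  under eq_integral => x _.
    rewrite fimfunE -fsumEFin// ge0_mule_fsuml; last first.
      by move=> r; exact: nnfun_muleindic_ge0.
    over.
  rewrite ge0_integral_fsum//; last 2 first.
  - move=> r; apply: emeasurable_funM => //; apply/measurable_EFinP.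
    apply: measurable_funM => //; under eq_fun do rewrite preI.
    exact: measurable_indic.
  - by move=> r x _; rewrite mule_ge0// nnfun_muleindic_ge0.
  apply: eq_fsbigr => r; rewrite inE => -[y _ <-].
  rewrite [in RHS]integral_mkcond -ge0_integralZl//; last 3 first.
  - by apply/(measurable_restrictT _ _).1 => //; exact: measurable_funTS.
  - by move=> x _; rewrite patchE; case: ifP.
  - by rewrite lee_fin.
  apply: eq_integral => x _.
  by rewrite epatch_indic preI EFinM -muleA [f x * _]muleC.
have -> : \int[mu]_x (h_ n (phi x))%:E =
    \sum_(r \in range (h_ n)) r%:E * mu (phi @^-1` (h_ n @^-1` [set r])).
  under eq_integral => x _ do rewrite fimfunE -fsumEFin//.
  rewrite ge0_integral_fsum//; last 2 first.
  - move=> r; apply/measurable_EFinP.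
    apply: measurable_funM => //; under eq_fun do rewrite preI.
    exact: measurable_indic.
  - by move=> r x _; rewrite nnfun_muleindic_ge0.
  apply: eq_fsbigr => r; rewrite inE => -[y _ <-].
  under eq_integral do rewrite preI EFinM.
  rewrite ge0_integralZl//; last 2 first.
  - by apply/measurable_EFinP; exact: measurable_indic.
  - by rewrite lee_fin.
  by rewrite integral_indic// setIT.
rewrite !fsbig_finite//=; apply: lee_sum => r _.
(* In the finite sum [r] is no longer known to be a value of [h_ n]; for negative [r] the preimage
   is empty and both terms vanish. *)
have [r0|r0] := ltP r 0%R.
  by rewrite preimage_nnfun0// preimage_set0 integral_set0 measure0.
by rewrite lee_wpmul2l ?lee_fin// fmu.
Qed.

(** * Change of measure on finite histories *)

(** The right-hand side is a measure in [B], so rectangles suffice; there the integral of the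
    product factors into one-coordinate integrals of [f] restricted to [A i]. *)
Lemma iid_density d (X : measurableType d) (R : realType)
    (P Q : probability X R) (PrP PrQ : probability (path_space X) R)
    (f : X -> \bar R) (n : nat) (B : set (history X n)) :
  is_iid_product P PrP -> is_iid_product Q PrQ ->
  measurable_fun setT f -> (forall x, 0 <= f x) ->
  (forall A, measurable A -> Q A = \int[P]_(x in A) f x) ->
  measurable B -> PrQ B = \int[PrP]_(w in B) \prod_(i < n) f (w i).
Proof.
move=> iidP iidQ mf f0 QE mB.
have [mF _] := ge0_integral_prod n iidP (fun=> mf) (fun=> f0).
pose F (w : path_space X) := \prod_(i < n) f (w i).
have mF' : measurable_fun setT F by exact: measurable_fun_history_path mF.
have F0 w : 0 <= F w by exact: prode_ge0.
pose m A := \int[PrP]_(w in A) F w.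
have m0 : m set0 = 0 by exact: integral_set0.
have m_ge0 A : 0 <= m A by exact: integral_ge0.
pose nu : {measure set (path_space X) -> \bar R} := HB.pack m
  (isMeasure.Build _ _ _ m m0 m_ge0 (semi_sigma_additive_nng_induced mF' F0)).
rewrite -[RHS]/(nu B); move: B mB; apply: history_measure_unique => [|A mA].
  by rewrite (le_lt_trans (probability_le1 _ _)) ?ltry.
apply: etrans (iidQ n A mA) _; rewrite -[RHS]/(m _) /m integral_mkcond.
have mfA i : measurable_fun setT (f \_ (A i)).
  by apply/(measurable_restrictT _ (mA i)).1; exact: measurable_funTS.
have fA0 i x : 0 <= (f \_ (A i)) x by rewrite patchE; case: ifP.
have [_ prodE] := ge0_integral_prod n iidP mfA fA0.
transitivity (\prod_(i < n) \int[P]_x (f \_ (A i)) x).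
  by apply: eq_bigr => i _; rewrite QE// integral_mkcond.
rewrite -prodE; apply: eq_integral => w _; rewrite patchE.
case: ifPn => [|/negP]; rewrite inE /= => Aw.
  by apply: eq_bigr => i _; rewrite patchE mem_set//; exact: Aw.
(* Off the rectangle one restricted factor is 0, which kills the product even if other factors are
   infinite. *)
have [i /not_implyP[lein Ai]] := (existsNP _).2 Aw.
by rewrite (bigD1 (Ordinal lein))//= patchE memNset// mul0e.
Qed.

(** * The wealth process and Ville's inequality *)

Lemma measurable_wealth d (X : measurableType d) (R : realType)
    (Pr0 : probability (path_space X) R) (E : nat -> path_space X -> \bar R)
    (n : nat) : betting_sequence Pr0 E ->
  measurable_fun setT (wealth E n : history X n -> \bar R).
Proof.
move=> hE; elim: n => [|n IH].
  apply: eq_measurable_fun (measurable_cst 1) => w _.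
  by rewrite /wealth big_geq.
apply: (eq_measurable_fun
  (fun w : history X n.+1 => wealth E n w * E n.+1 w)).
  by move=> w _; rewrite /wealth [in RHS]big_nat_recr.
apply: emeasurable_funM; first exact: measurable_fun_historyS (leqnSn n) IH.
by have [] := hE n.
Qed.

Lemma wealth_ge0 d (X : measurableType d) (R : realType)
    (Pr0 : probability (path_space X) R) (E : nat -> path_space X -> \bar R)
    (n : nat) (w : path_space X) : betting_sequence Pr0 E -> 0 <= wealth E n w.
Proof.
move=> hE; rewrite /wealth big_nat; apply: prode_ge0 => -[//|k] _.
by have [_ + _] := hE k.
Qed.

(** For [c = alpha^-1] this is the event that the stopping time exceeds [n], written so that its
    F_n-measurability is visible. The index 0 is left out, as in [stopping_time]. *)
Definition no_crossing T (R : realType) (E : nat -> T -> \bar R) (c : R)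
    (n : nat) : set T :=
  [set w | forall k, (0 < k <= n)%N -> wealth E k w <= c%:E].

Lemma no_crossingS T (R : realType) (E : nat -> T -> \bar R) (c : R) (n : nat) :
  no_crossing E c n.+1 =
  no_crossing E c n `&` [set w | wealth E n.+1 w <= c%:E].
Proof.
apply/seteqP; split => w /=.
  move=> h; split; last by apply: h => /=.
  by move=> k /andP[k0 kn]; apply: h; rewrite k0 (leq_trans kn).
move=> [h hn] k /andP[k0]; rewrite leq_eqVlt => /orP[/eqP ->//|kn].
by apply: h; rewrite k0.
Qed.

Lemma measurable_no_crossing d (X : measurableType d) (R : realType)
    (Pr0 : probability (path_space X) R) (E : nat -> path_space X -> \bar R)
    (c : R) (n : nat) : betting_sequence Pr0 E ->
  measurable (no_crossing E c n : set (history X n)).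
Proof.
move=> hE; elim: n => [|n IH].
  rewrite (_ : no_crossing _ _ _ = setT)//.
  by apply/seteqP; split => // w _ k; case: k.
rewrite no_crossingS; apply: measurableI.
  exact: measurable_historyS IH.
have := emeasurable_fun_infty_c measurableT
  (measurable_wealth (n := n.+1) hE) c%:E.
by rewrite setTI.
Qed.

(** The supermartingale step. A conditional expectation bounded by 1 makes the integral of [E n.+1]
    over each F_n-event at most the probability of that event; [le_integral_density] passes from
    events to [h]. *)
Lemma betting_integral_le d (X : measurableType d) (R : realType)
    (Pr0 : probability (path_space X) R) (E : nat -> path_space X -> \bar R)
    (n : nat) (h : (nat -> X) -> \bar R) :
  betting_sequence Pr0 E ->
  measurable_fun setT (h : history X n -> \bar R) -> (forall w, 0 <= h w) ->
  \int[Pr0]_w (h w * E n.+1 w) <= \int[Pr0]_w h w.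
Proof.
move=> hE mh h0; have [mE E0 [g [[mg g0 gE] g1]]] := hE n.
have mid : measurable_fun setT (id : path_space X -> history X n).
  by move=> _ B mB; rewrite setTI; exact: measurable_history_path mB.
apply: (le_integral_density mid) => //.
  exact: measurable_fun_history_path mE.
move=> B mB; rewrite preimage_id -gE//.
have mB' := measurable_history_path mB.
rewrite -[leRHS]mul1e -integral_cst//.
apply: ae_ge0_le_integral => //.
- apply: measurable_funTS; exact: measurable_fun_history_path mg.
- by apply: filterS g1 => w g1w _.
Qed.

(* The left-hand side plus the wealth on the paths that have not crossed yet is
   nonincreasing in [n], so no stopped process is needed. *)
Lemma ville d (X : measurableType d) (R : realType)
    (Pr0 : probability (path_space X) R) (E : nat -> path_space X -> \bar R)
    (c : R) (n : nat) : betting_sequence Pr0 E -> (0 <= c)%R ->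
  c%:E * Pr0 (~` no_crossing E c n) <= 1.
Proof.
move=> hE c0.
suff : c%:E * Pr0 (~` no_crossing E c n) +
    \int[Pr0]_(w in no_crossing E c n) wealth E n w <= 1.
  apply: le_trans; rewrite leeDl// integral_ge0// => w _.
  exact: wealth_ge0 hE.
have mA k := measurable_history_path (measurable_no_crossing c (n := k) hE).
have mW k := measurable_fun_history_path (measurable_wealth (n := k) hE).
have W0 k w := wealth_ge0 k w hE.
elim: n => [|n IH].
  have -> : no_crossing E c 0 = setT.
    by apply/seteqP; split => // w _ k; case: k.
  rewrite setCT measure0 mule0 add0e.
  under eq_integral do rewrite /wealth big_geq//.
  by rewrite integral_cst// mul1e probability_le1.
apply: le_trans IH.
(* [S] is the event that the first crossing happens exactly at time [n.+1]. It moves from the wealth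
   term to the probability term. *)
pose A := no_crossing E c n; pose S := A `\` no_crossing E c n.+1.
have mS : measurable S by exact: (measurableD (mA n) (mA n.+1)).
have AE : A = no_crossing E c n.+1 `|` S.
  rewrite /S no_crossingS setDIr setDv set0U -/A.
  by apply/seteqP; split => w /=; have := EM (wealth E n.+1 w <= c%:E); tauto.
have step : \int[Pr0]_(w in A) wealth E n.+1 w <= \int[Pr0]_(w in A) wealth E n w.
  rewrite !(integral_mkcond A).
  rewrite [leLHS](_ : _ =
      \int[Pr0]_w ((wealth E n \_ A) w * E n.+1 w)); last first.
    apply: eq_integral => w _; rewrite !patchE; case: ifP; rewrite ?mul0e// => _.
    by rewrite /wealth big_nat_recr.
  apply: betting_integral_le => //.
    apply/(measurable_restrictT _ _).1.
      exact: (measurable_no_crossing c (n := n) hE).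
    exact: measurable_funTS (measurable_wealth (n := n) hE).
  by move=> w; rewrite patchE; case: ifP.
have intA : \int[Pr0]_(w in A) wealth E n.+1 w =
    \int[Pr0]_(w in no_crossing E c n.+1) wealth E n.+1 w +
    \int[Pr0]_(w in S) wealth E n.+1 w.
  rewrite AE ge0_integral_setU//; last 2 first.
  - by apply: measurable_funTS; exact: mW.
  - by rewrite disj_set2E /S setDIK.
have PA : Pr0 (~` no_crossing E c n.+1) = Pr0 (~` A) + Pr0 S.
  rewrite -measureU//; last 2 first.
    exact: (measurableC (mA n)).
    by rewrite /S setDE setIA setICl set0I.
  congr (Pr0 _); rewrite /S no_crossingS setCI setDIr setDv set0U.
  by apply/seteqP; split => w /=; have := EM (A w); tauto.
have intS : c%:E * Pr0 S <= \int[Pr0]_(w in S) wealth E n.+1 w.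
  rewrite -integral_cst//; apply: ge0_le_integral => //.
    by apply: measurable_funTS; exact: mW.
  move=> w; rewrite /S no_crossingS => -[Aw /= /not_andP[//|/negP]].
  by rewrite -ltNge => /ltW.
(* On [A] the expected wealth does not grow ([step]), and the part of it carried by [S] pays for the
   new probability [c%:E * Pr0 S] ([intS]). *)
apply: le_trans (leeD2l _ step); rewrite intA PA ge0_muleDr//.
rewrite -(addeA (c%:E * Pr0 (~` A))) leeD2l//.
by rewrite [leRHS]addeC leeD2r.
Qed.

(** * The upper tail of the law of large numbers *)

Lemma markov_ge0 d (T : measurableType d) (R : realType)
    (mu : {measure set T -> \bar R}) (f : T -> \bar R) (c : R) :
  (0 <= c)%R -> measurable_fun setT f -> (forall x, 0 <= f x) ->
  c%:E * mu [set x | c%:E <= f x] <= \int[mu]_x f x.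
Proof.
move=> c0 mf f0.
have mS : measurable [set x | c%:E <= f x].
  by have := emeasurable_fun_c_infty measurableT mf c%:E; rewrite setTI.
rewrite -integral_cst//.
apply: (@le_trans _ _ (\int[mu]_(x in [set x | c%:E <= f x]) f x)).
  by apply: ge0_le_integral => //; exact: measurable_funTS.
exact: ge0_subset_integral.
Qed.

(** From [expR (- x) >= 1 - x] one gets [expR x <= (1 - x)^-1], and [(1 - x) * (1 + x + 2 * x ^+ 2)]
    is at least 1 when [x <= 2^-1]. *)
Lemma expR_le_quadratic (R : realType) (x : R) :
  (x <= 2^-1 -> expR x <= 1 + x + 2 * x ^+ 2)%R.
Proof.
move=> x2; have hx : (0 < 1 - x)%R by lra.
have : (expR x <= (1 - x)^-1)%R.
  rewrite -[x in expR x]opprK expRN lef_pV2 ?posrE ?expR_gt0//.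
  exact: expR_ge1Dx.
move=> /le_trans; apply; rewrite -(ler_pM2l hx) divff ?gt_eqF//.
have -> : ((1 - x) * (1 + x + 2 * x ^+ 2) = 1 + x ^+ 2 * (1 - 2 * x))%R by ring.
by rewrite lerDl mulr_ge0 ?sqr_ge0//; lra.
Qed.

(** Chernoff's method: Markov's inequality for the product of the factors [expR (l * U (w i))] gives
    the [n]-th power of one exponential moment, and the negative mean of [U] brings that moment
    below 1 for small [l]. *)
Lemma iid_bounded_upper_tail d (X : measurableType d) (R : realType)
    (P : probability X R) (Pr : probability (path_space X) R)
    (U : X -> R) (K e u : R) :
  is_iid_product P Pr -> (0 < e <= K)%R -> measurable_fun setT U ->
  (forall x, `|U x| <= K)%R -> \int[P]_x (U x)%:E = u%:E -> (u <= - e)%R ->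
  exists2 rho : R, (0 <= rho < 1)%R & forall n,
    Pr [set w | (0 <= \sum_(i < n) U (w i))%R] <= (rho ^+ n)%:E.
Proof.
move=> iid /andP[e0 eK] mU UK intU ue.
have K0 : (0 < K)%R by exact: lt_le_trans eK.
have iU : P.-integrable setT (EFin \o U).
  apply: measurable_bounded_integrable => //.
    by rewrite (le_lt_trans (probability_le1 _ _)) ?ltry.
  exists K; split; first exact: num_real.
  by move=> y Ky x _; exact: (le_trans (UK x) (ltW Ky)).
(* [l] minimizes the bound [1 - l * e + 2 * (l * K) ^+ 2] on the mean of
   [expR (l * U)]. *)
pose l : R := (e / (4 * K ^+ 2))%R.
have l0 : (0 < l)%R by rewrite divr_gt0// mulr_gt0// exprn_gt0.
have lK : (l * K <= 2^-1)%R.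
  rewrite /l mulrAC ler_pdivrMr ?mulr_gt0 ?exprn_gt0//.
  by rewrite (_ : 2^-1 * (4 * K ^+ 2) = 2 * K * K)%R; [nra|field].
have Ubound x : (expR (l * U x) <= 1 + 2 * (l * K) ^+ 2 + l * U x)%R.
  have [U1 U2] : (U x <= K)%R /\ (- K <= U x)%R.
    by have := UK x; rewrite ler_norml => /andP[].
  apply: (le_trans (expR_le_quadratic _)); first by nra.
  have : ((l * U x) ^+ 2 <= (l * K) ^+ 2)%R.
    by rewrite !exprMn ler_wpM2l ?sqr_ge0//; nra.
  by lra.
(* With the chosen [l] this equals [1 - e ^+ 2 / (8 * K ^+ 2)], which lies in [0, 1) because
   [0 < e <= K]. *)
pose rho : R := (1 + 2 * (l * K) ^+ 2 - l * e)%R.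
have rhoE : rho = (1 - e ^+ 2 / (8 * K ^+ 2))%R.
  by rewrite /rho /l; field; rewrite gt_eqF.
have mexp : measurable_fun setT (fun x => (expR (l * U x))%:E).
  apply/measurable_EFinP; apply: measurableT_comp => //.
  exact: measurable_funM.
have intexp : \int[P]_x (expR (l * U x))%:E <= rho%:E.
  apply: (@le_trans _ _ (\int[P]_x ((1 + 2 * (l * K) ^+ 2)%:E + l%:E * (U x)%:E))).
    apply: ge0_le_integral => //.
    - apply: emeasurable_funD => //; apply: emeasurable_funM => //.
      exact/measurable_EFinP.
    - by move=> x _; rewrite -EFinM -EFinD lee_fin.
  rewrite integralD//; last 2 first.
  - exact: finite_measure_integrable_cst.
  - exact: integrableZl.
  have -> : \int[P]_x (1 + 2 * (l * K) ^+ 2)%:E = (1 + 2 * (l * K) ^+ 2)%:E.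
    by rewrite integral_cst// -[RHS]mule1; congr (_ * _); exact: probability_setT.
  rewrite integralZl// intU.
  by rewrite -EFinM -EFinD lee_fin /rho; nra.
exists rho => [|n].
  rewrite rhoE; apply/andP; split.
    rewrite subr_ge0 ler_pdivrMr ?mulr_gt0 ?exprn_gt0// mul1r.
    by nra.
  by rewrite ltrBlDr ltrDl divr_gt0 ?mulr_gt0 ?exprn_gt0.
pose F (w : path_space X) := \prod_(i < n) (expR (l * U (w i)))%:E.
have FE w : F w = (expR (l * \sum_(i < n) U (w i)))%:E.
  by rewrite /F prodEFin mulr_sumr expR_sum.
have [mF intF] := ge0_integral_prod n iid (fun=> mexp)
  (fun i x => ltac:(by rewrite lee_fin expR_ge0)).
have setE : [set w : path_space X | (0 <= \sum_(i < n) U (w i))%R] =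
    [set w | 1%:E <= F w].
  apply/seteqP; split => w /=; rewrite FE lee_fin -[1%R]expR0 ler_expR.
    by move=> h; rewrite mulr_ge0// ltW.
  by rewrite pmulr_rge0.
rewrite (_ : Pr _ = 1 * Pr [set w | 1%:E <= F w]); last first.
  by rewrite mul1e -setE.
apply: (le_trans (markov_ge0 _ _ _ _)) => //.
- exact: measurable_fun_history_path mF.
- by move=> w; rewrite FE lee_fin expR_ge0.
have int0 : 0 <= \int[P]_x (expR (l * U x))%:E.
  by apply: integral_ge0 => x _; rewrite lee_fin expR_ge0.
rewrite intF; move: int0 intexp; case: (\int[P]_x _) => //= r.
rewrite !lee_fin => r0 rrho; rewrite prodEFin lee_fin prodr_const card_ord.
by rewrite lerXn2r// nnegrE (le_trans r0).
Qed.

Lemma ge0_integral_coordinate d (X : measurableType d) (R : realType)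
    (P : probability X R) (Pr : probability (path_space X) R) (n : nat)
    (f : X -> \bar R) :
  is_iid_product P Pr -> measurable_fun setT f -> (forall x, 0 <= f x) ->
  \int[Pr]_w f (w n) = \int[P]_x f x.
Proof.
move=> iid mf f0.
have := ge0_integral_indep (n := n) iid (measurable_cst 1) (fun=> lee01) mf f0.
under eq_integral do rewrite mul1e.
move=> ->; rewrite integral_cst// mul1e -[RHS]mul1e; congr (_ * _).
exact: probability_setT.
Qed.

Lemma measurable_sum_coordinates d (X : measurableType d) (R : realType)
    (f : X -> R) (n : nat) : measurable_fun setT f ->
  measurable_fun setT (fun w : history X n => \sum_(i < n) f (w i))%R.
Proof.
move=> mf; apply: measurable_sum => i.
apply: (measurableT_comp mf); exact: measurable_coordinate_history.
Qed.

(** A first-moment bound that does not improve with [n]. It serves for the truncation remainder,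
    whose mean is made small beforehand. *)
Lemma iid_markov d (X : measurableType d) (R : realType)
    (P : probability X R) (Pr : probability (path_space X) R)
    (f : X -> R) (e m : R) (n : nat) :
  is_iid_product P Pr -> measurable_fun setT f -> (forall x, 0 <= f x)%R ->
  \int[P]_x (f x)%:E <= m%:E -> (0 < e)%R -> (0 < n)%N ->
  Pr [set w | (n%:R * e <= \sum_(i < n) f (w i))%R] <= (m / e)%:E.
Proof.
move=> iid mf f0 intf e0 n0.
have mF := measurable_fun_history_path (measurable_sum_coordinates (n := n) mf).
have n0' : (0 < n%:R :> R)%R by rewrite ltr0n.
have ne0 : (0 < n%:R * e)%R by exact: mulr_gt0.
have /measurable_EFinP mEf := mf.
have intF : \int[Pr]_w (\sum_(i < n) f (w i))%:E = \sum_(i < n) \int[P]_x (f x)%:E.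
  under eq_integral do rewrite -sumEFin.
  rewrite ge0_integral_sum//; last 2 first.
  - move=> i; apply: (measurableT_comp mEf); exact: measurable_coordinate.
  - by move=> i w _; rewrite lee_fin.
  by apply: eq_bigr => i _; exact: (ge0_integral_coordinate i iid mEf).
have int0 : 0 <= \int[P]_x (f x)%:E.
  by apply: integral_ge0 => x _; rewrite lee_fin.
have -> : (m / e = (n%:R * e)^-1 * (n%:R * m))%R.
  by field; rewrite !gt_eqF.
rewrite EFinM lee_pdivlMl//.
apply: (@le_trans _ _ (\int[Pr]_w (\sum_(i < n) f (w i))%:E)).
  apply: markov_ge0; rewrite ?ltW//; first exact/measurable_EFinP.
  by move=> w; rewrite lee_fin sumr_ge0.
rewrite intF; move: int0 intf; case: (\int[P]_x _) => //= r.
rewrite !lee_fin => r0 rm; rewrite sumEFin sumr_const card_ord lee_fin.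
by rewrite -[(r *+ n)%R]mulr_natl ler_pM2l.
Qed.

(** Dominated convergence: the truncated tails tend to 0 pointwise and are bounded by the absolute
    value of [f]. *)
Lemma integrable_tail d (T : measurableType d) (R : realType)
    (mu : {measure set T -> \bar R}) (f : T -> R) (e : R) :
  mu.-integrable setT (EFin \o f) -> (0 < e)%R ->
  exists n : nat,
    \int[mu]_x (`|f x| * \1_[set y | (n%:R < `|f y|)%R] x)%:E <= e%:E.
Proof.
move=> intf e0; have /integrableP[/measurable_EFinP mf _] := intf.
pose S n := [set y | (n%:R < `|f y|)%R].
have mS n : measurable (S n).
  have mEf : measurable_fun setT (abse \o (EFin \o f)).
    by apply: measurableT_comp => //; exact/measurable_EFinP.
  have := emeasurable_fun_o_infty measurableT mEf n%:R%:E; rewrite setTI.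
  by congr measurable; apply/seteqP; split => x /=; rewrite lte_fin.
have mg n : measurable_fun setT (fun x => (`|f x| * \1_(S n) x)%:E).
  apply/measurable_EFinP; apply: measurable_funM => //.
  exact: measurableT_comp.
have [||_ _] := @dominated_convergence _ _ _ mu setT measurableT
  (fun n x => (`|f x| * \1_(S n) x)%:E) (cst 0) (abse \o (EFin \o f)) mg
  (measurable_cst 0) _ (integrable_abse intf) _.
- apply: aeW => x _; apply: cvg_near_cst.
  exists (Num.bound `|f x|) => // n /= nf.
  rewrite indicE memNset ?mulr0// /S /= => /ltW.
  apply/negP; rewrite -ltNge.
  apply: (lt_le_trans (archi_boundP (normr_ge0 _))).
  by rewrite ler_nat.
- apply: aeW => x n _ /=; rewrite lee_fin normrM normr_id.
  by rewrite -[leRHS]mulr1 ler_wpM2l// indicE; case: (_ \in _); rewrite ?normr1 ?normr0.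
rewrite integral0 => /fine_cvgP[fin /cvgr_le/(_ e e0) small].
near \oo => n; exists n; rewrite -[leLHS]fineK; last by near: n.
by rewrite lee_fin; near: n.
Unshelve. all: by end_near. Qed.

(** [Z] is split into a bounded part [Y] and a remainder dominated by [T]. The margin [3 * e] is
    spent in equal shares: truncation moves the mean by at most [e], the Chernoff bound for [Y]
    needs [e] above its mean, and Markov's inequality for [T] needs [e]. *)
Lemma iid_upper_tail d (X : measurableType d) (R : realType)
    (P : probability X R) (Pr : probability (path_space X) R)
    (Z : X -> R) (D e eta : R) :
  is_iid_product P Pr -> P.-integrable setT (EFin \o Z) ->
  \int[P]_x (Z x)%:E = D%:E -> (0 < e)%R -> (0 < eta)%R ->
  \forall n \near \oo,
    Pr [set w | (n%:R * (D + 3 * e) < \sum_(i < n) Z (w i))%R] <= eta%:E.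
Proof.
move=> iid iZ intZ e0 eta0; have /integrableP[/measurable_EFinP mZ _] := iZ.
(* The bound [e] controls the shift of the mean; the bound [eta * e / 2] makes Markov's inequality
   at level [e] yield [eta / 2]. *)
pose de : R := Num.min e (eta * e / 2)%R.
have de0 : (0 < de)%R by rewrite lt_min e0 divr_gt0// mulr_gt0.
have [M] := integrable_tail iZ de0; set S := [set y | _].
pose T x : R := (`|Z x| * \1_S x)%R => intT.
pose Y x : R := (Z x - Z x * \1_S x)%R.
have mS : measurable S.
  have mEf : measurable_fun setT (abse \o (EFin \o Z)).
    by apply: measurableT_comp => //; exact/measurable_EFinP.
  have := emeasurable_fun_o_infty measurableT mEf M%:R%:E; rewrite setTI.
  by congr measurable; apply/seteqP; split => x /=; rewrite lte_fin.
have mT : measurable_fun setT T.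
  by apply: measurable_funM => //; exact: measurableT_comp.
have mY : measurable_fun setT Y.
  by apply: measurable_funB => //; exact: measurable_funM.
have T0 x : (0 <= T x)%R by rewrite mulr_ge0.
have YM x : (`|Y x| <= M%:R)%R.
  rewrite /Y indicE; case: (boolP (x \in S)) => xS.
    by rewrite mulr1 subrr normr0.
  rewrite mulr0 subr0 leNgt; apply/negP => MZ.
  by move/negP : xS; apply; rewrite inE.
have ZYT x : (`|Z x - Y x| <= T x)%R.
  rewrite /Y /T opprB addrC subrK normrM.
  by rewrite ler_wpM2l// indicE; case: (_ \in _); rewrite ?normr1 ?normr0.
have iY : P.-integrable setT (EFin \o Y).
  apply: measurable_bounded_integrable => //.
    by rewrite (le_lt_trans (probability_le1 _ _)) ?ltry.
  exists M%:R; split; first exact: num_real.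
  by move=> y My x _; exact: (le_trans (YM x) (ltW My)).
have iT : P.-integrable setT (EFin \o T).
  apply/integrableP; split; first exact/measurable_EFinP.
  under eq_integral do rewrite /= ger0_norm//.
  by rewrite (le_lt_trans intT) ?ltry.
have [m intY] : exists m, \int[P]_x (Y x)%:E = m%:E.
  exists (fine (\int[P]_x (Y x)%:E)); rewrite fineK//.
  exact: integrable_fin_num.
have mD : (m <= D + e)%R.
  rewrite -lee_fin -intY EFinD -intZ.
  apply: (@le_trans _ _ (\int[P]_x ((Z x)%:E + (T x)%:E))).
    apply: le_integral => //; first exact: integrableD.
    move=> x _; rewrite -EFinD lee_fin.
    by have := ZYT x; rewrite ler_norml => /andP[]; lra.
  rewrite integralD// leeD2l// (le_trans intT)// lee_fin.
  by rewrite /de ge_min lexx.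
(* The shift makes the mean exactly [- e], so that large sums of [Y] become nonnegative sums of
   [U]. *)
pose U x : R := (Y x - (m + e))%R.
have mU : measurable_fun setT U by exact: measurable_funB.
have UK x : (`|U x| <= M%:R + `|m| + e)%R.
  rewrite (le_trans (ler_normB _ _))// -addrA lerD//.
  by rewrite (le_trans (ler_normD _ _))// (gtr0_norm e0).
have intU : \int[P]_x (U x)%:E = (- e)%:E.
  under eq_integral do rewrite /U EFinB.
  rewrite integralB//; last exact: finite_measure_integrable_cst.
  have -> : \int[P]_x (m + e)%:E = (m + e)%:E.
    by rewrite integral_cst// -[RHS]mule1; congr (_ * _); exact: probability_setT.
  by rewrite intY -EFinB; congr (_%:E); ring.
have eK : (0 < e <= M%:R + `|m| + e)%R by rewrite e0 lerDr addr_ge0.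
have [rho /andP[rho0 rho1] rhoU] := iid_bounded_upper_tail iid eK mU UK intU (lexx _).
have : (rho ^+ n)%R @[n --> \oo] --> (0 : R)%R.
  by apply: cvg_expr; rewrite ger0_norm.
have eta2 : (0 < eta / 2)%R by rewrite divr_gt0.
move=> /cvgr_le/(_ _ eta2) rho_small.
near=> n.
have n0 : (0 < n)%N by near: n; exists 1%N.
have mSum (f : X -> R) : measurable_fun setT f ->
    measurable_fun setT (fun w : path_space X => (\sum_(i < n) f (w i))%:E).
  move=> mf; apply/measurable_EFinP.
  exact: measurable_fun_history_path (measurable_sum_coordinates (n := n) mf).
pose A := [set w : path_space X | (0 <= \sum_(i < n) U (w i))%R].
pose B := [set w : path_space X | (n%:R * e <= \sum_(i < n) T (w i))%R].
have mA : measurable A.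
  have := emeasurable_fun_c_infty measurableT (mSum U mU) 0%:E.
  by rewrite setTI.
have mB : measurable B.
  have := emeasurable_fun_c_infty measurableT (mSum T mT) (n%:R * e)%:E.
  by rewrite setTI.
have mC : measurable
    [set w : path_space X | (n%:R * (D + 3 * e) < \sum_(i < n) Z (w i))%R].
  have := emeasurable_fun_o_infty measurableT (mSum Z mZ) (n%:R * (D + 3 * e))%:E.
  by rewrite setTI.
apply: (@le_trans _ _ (Pr (A `|` B))).
  apply: le_measure; rewrite ?inE//; first exact: measurableU.
  move=> w /= ZD.
  have [UA|UA] := leP 0%R (\sum_(i < n) U (w i))%R; first by left.
  have [TB|TB] := leP (n%:R * e)%R (\sum_(i < n) T (w i))%R; first by right.
  exfalso.
  have : (\sum_(i < n) Z (w i) <= \sum_(i < n) (U (w i) + (m + e) + T (w i)))%R.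
    apply: ler_sum => i _; rewrite /U subrK.
    by have := ZYT (w i); rewrite ler_norml => /andP[]; lra.
  rewrite 2!big_split/= sumr_const card_ord -[((m + e) *+ n)%R]mulr_natl.
  have : (n%:R * (m + e) <= n%:R * (D + e + e))%R by rewrite ler_wpM2l// lerD2r.
  by lra.
rewrite (le_trans (measureU2 _ _ _))//.
rewrite [eta]splitr EFinD leeD//.
  by apply: (le_trans (rhoU n)); rewrite lee_fin; near: n.
apply: (le_trans (iid_markov iid mT T0 intT e0 n0)).
rewrite lee_fin ler_pdivrMr// /de ge_min; apply/orP; right.
by rewrite mulrAC.
Unshelve. all: by end_near. Qed.

(** * The log-likelihood ratio *)

Lemma null_dominates_measure0 d (T : measurableType d) (R : realType)
    (mu nu : {measure set T -> \bar R}) (N : set T) :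
  nu `<< mu -> measurable N -> mu N = 0 -> nu N = 0.
Proof.
move=> numu mN /(measure0_null_setP mu mN) /numu.
by move/(measure0_null_setP nu mN).
Qed.

Lemma null_dominates_ae d (T : measurableType d) (R : realType)
    (mu nu : {measure set T -> \bar R}) (Q : T -> Prop) :
  nu `<< mu -> {ae mu, forall x, Q x} -> {ae nu, forall x, Q x}.
Proof.
move=> numu [N [mN N0 QN]]; exists N; split => //.
exact: null_dominates_measure0 N0.
Qed.

(* [Z] is the log-likelihood ratio, with density ratio reset to [1] where it
   vanishes, a null set of both measures. *)
Lemma KL_log_density d (X : measurableType d) (R : realType)
    (P0 P1 : probability X R) :
  P1 `<< P0 -> KL P0 P1 < +oo ->
  exists Z : X -> R, [/\ P0.-integrable setT (EFin \o Z),
    KL P0 P1 = \int[P0]_x (Z x)%:E &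
    forall A, measurable A -> P1 A = \int[P0]_(x in A) (expR (- Z x))%:E].
Proof.
move=> ac10; rewrite /KL; case: pselect => // ac01.
set f := Radon_Nikodym _ _ => /= KLoo.
(* A version of the density [f] of [P0] with respect to [P1] that is nonnegative at every point and
   comes with a change of variables formula. *)
pose g := Radon_Nikodym_SigmaFinite.f P0 P1.
have g0 x : 0 <= g x by exact: Radon_Nikodym_SigmaFinite.f_ge0.
have gfin x : g x \is a fin_num by exact: Radon_Nikodym_SigmaFinite.f_fin_num.
have mg : measurable_fun setT g.
  exact: measurable_int (Radon_Nikodym_SigmaFinite.f_integrable ac01).
have intg A : measurable A -> P0 A = \int[P1]_(x in A) g x.
  exact: Radon_Nikodym_SigmaFinite.f_integral.
have gchange h A : (forall x, 0 <= h x) -> measurable A ->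
    measurable_fun A h -> \int[P1]_(x in A) (h x * g x) = \int[P0]_(x in A) h x.
  exact: Radon_Nikodym_SigmaFinite.change_of_variables.
have mN : measurable [set x | g x <= 0].
  by have := emeasurable_fun_infty_c measurableT mg 0; rewrite setTI.
have P0N : P0 [set x | g x <= 0] = 0.
  rewrite intg// integral0_eq// => x /= gx.
  by apply/eqP; rewrite eq_le gx g0.
have P1N : P1 [set x | g x <= 0] = 0.
  exact: null_dominates_measure0 P0N.
pose L x : R := if (0 < fine (g x))%R then fine (g x) else 1%R.
have mL : measurable_fun setT L.
  apply: measurable_fun_ifT => //; last exact: measurableT_comp.
  by apply: measurable_fun_ltr => //; exact: measurableT_comp.
have L0 x : (0 < L x)%R by rewrite /L; case: ifP.
have LE x : ~ (g x <= 0) -> (L x)%:E = g x.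
  move/negP; rewrite -ltNge => gx; rewrite /L fine_gt0 ?fineK//.
  by rewrite gx/= -ge0_fin_numE ?g0//; exact: gfin.
pose Z x : R := ln (L x).
have mZ : measurable_fun setT Z by exact: measurableT_comp.
have expZ x : expR (- Z x) = ((L x)^-1)%R by rewrite expRN lnK// posrE.
have intZ : \int[P0]_x lne (f x) = \int[P0]_x (Z x)%:E.
  have ffin x : f x \is a fin_num by exact: Radon_Nikodym_fin_num.
  have mf : measurable_fun setT f.
    by apply: (measurable_int P1); exact: Radon_Nikodym_integrable.
  apply: ae_eq_integral => //.
  - apply: (eq_measurable_fun (fun x =>
      if (fine (f x) <= 0)%R then -oo else (ln (fine (f x)))%:E)).
      by move=> x _; rewrite -[in RHS](fineK (ffin x)).
    apply: measurable_fun_ifT => //.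
      by apply: measurable_fun_ler => //; exact: measurableT_comp.
    apply/measurable_EFinP; apply: measurableT_comp => //.
    exact: measurableT_comp.
    exact/measurable_EFinP.
  (* The two versions agree [P1]-almost everywhere; since the integral is taken under [P0], the
     exceptional set is carried over by [ac01]. *)
  have fg := null_dominates_ae ac01
    (ae_eq_Radon_Nikodym_SigmaFinite ac01 measurableT).
  have gN : {ae P0, forall x, ~ (g x <= 0)}.
    exists [set x | g x <= 0]; split => // x /=.
    by move=> /contrapT.
  move: fg gN; apply: filterS2 => x /(_ I) fgx gx _.
  by rewrite /f -fgx -/g -(LE x gx) lne_EFin.
exists Z; split => //.
- (* [L * ln (1 / L) <= 1] bounds the negative part, so that [KL < +oo] is not
     the junk value [+oo - oo]. *)
  have intneg : \int[P0]_x ((EFin \o Z)^\- x) <= 1.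
    rewrite -gchange//; last by apply: measurable_funeneg; exact/measurable_EFinP.
    apply: (@le_trans _ _ (\int[P1]_x 1)).
      apply: ge0_le_integral => //.
      + by move=> x _; rewrite mule_ge0.
      + apply: emeasurable_funM => //.
        by apply: measurable_funeneg; exact/measurable_EFinP.
      move=> x _.
      have [gx|gx] := leP (g x) 0.
        by have -> : g x = 0; [apply/eqP; rewrite eq_le gx g0|rewrite mule0].
      rewrite -LE; last by apply/negP; rewrite -ltNge.
      rewrite funenegE /= -EFin_max -EFinM lee_fin maxr_pMl ?(ltW (L0 x))// mul0r.
      rewrite ge_max ler01 andbT -ler_pdivlMr// mul1r /Z -lnV ?posrE//.
      by rewrite ltW// ln_sublinear// invr_gt0.
    by rewrite integral_cst// mul1e probability_le1.
  have intpos : \int[P0]_x ((EFin \o Z)^\+ x) < +oo.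
    move: KLoo; rewrite intZ integralE.
    have : \int[P0]_x ((EFin \o Z)^\- x) \is a fin_num.
      rewrite ge0_fin_numE ?(le_lt_trans intneg) ?ltry//.
      exact: integral_ge0.
    case: (\int[P0]_x ((EFin \o Z)^\- x)) => //= r _.
    by case: (\int[P0]_x ((EFin \o Z)^\+ x)) => [s _||_]; rewrite ?ltry ?ltNyr ?addye.
  apply/integrableP; split; first exact/measurable_EFinP.
  rewrite -[fun x => _]/(abse \o (EFin \o Z)) fune_abse.
  rewrite ge0_integralD//; last 2 first.
  + by apply: measurable_funepos; exact/measurable_EFinP.
  + by apply: measurable_funeneg; exact/measurable_EFinP.
  by rewrite lte_add_pinfty// (le_lt_trans intneg) ?ltry.
- move=> A mA.
  have mE : measurable_fun setT (fun x => (expR (- Z x))%:E).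
    apply/measurable_EFinP; apply: measurableT_comp => //.
    exact: measurable_funN.
  (* Under [P1] the integrand becomes [expR (- Z x) * g x], which is 1 wherever [g] is positive. The
     remaining set is [P1]-null by [P1 << P0], so no mass of [P1] is lost. *)
  rewrite -gchange//; last exact: measurable_funTS.
  rewrite -[LHS]mul1e -integral_cst//; apply: ae_eq_integral => //.
    by apply: measurable_funTS; exact: emeasurable_funM.
  exists [set x | g x <= 0]; split => // x /=; apply: contra_notP => gx _.
  by rewrite expZ -(LE x gx) -EFinM mulVf// gt_eqF.
Qed.

(** * Exponential rates and the conclusion *)

(** The constant [c] contributes only [ln c / t] to the rate, which vanishes in the limit; half of
    the slack [e] absorbs it and the other half goes into the hypothesis. *)
Lemma decay_rate_le (R : realType) (p : nat -> \bar R) (D c : R) :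
  (0 < c)%R ->
  (forall e : R, (0 < e)%R ->
    \forall n \near \oo, (c * expR (- (n%:R * (D + e))))%:E <= p n) ->
  decay_rate p <= D%:E.
Proof.
move=> c0 plb; apply/lee_addgt0Pr => e e0.
have e2 : (0 < e / 2)%R by rewrite divr_gt0.
have /plb [N _ pN] := e2.
(* From [M] on, the lower bound for slack [e / 2] applies, [t] is positive, and the absolute value
   of [ln c] is at most [t * (e / 2)]. *)
pose M := maxn N.+1 (Num.bound (`|ln c| / (e / 2))).
rewrite /decay_rate /limn_esup limf_esupE.
apply: (@le_trans _ _ (ereal_sup ((fun t => - (t%:R^-1%:E * lne (p t))) @`
    [set t | (M <= t)%N]))).
  by apply: ereal_inf_lbound; exists [set t | (M <= t)%N] => //; exists M.
apply: ge_ereal_sup => _ [t /= Mt <-].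
have tN : (N < t)%N by rewrite (leq_trans _ Mt)// leq_max ltnSn.
have t0 : (0 < t%:R :> R)%R by rewrite ltr0n (leq_trans _ tN).
have ct : (`|ln c| <= t%:R * (e / 2))%R.
  rewrite -ler_pdivrMr// ltW//.
  apply: (lt_le_trans (archi_boundP _)); first by rewrite divr_ge0// ltW.
  by rewrite ler_nat (leq_trans _ Mt)// leq_max leqnn orbT.
have q0 : (0 < c * expR (- (t%:R * (D + e / 2))))%R by rewrite mulr_gt0// expR_gt0.
have lnp : (ln c - t%:R * (D + e / 2))%:E <= lne (p t).
  have := pN t (ltnW tN); rewrite /= -lee_lne.
  - by rewrite lne_EFin// lnM ?posrE ?expR_gt0// expRK.
  - by rewrite in_itv/= leey andbT lee_fin ltW.
  - rewrite in_itv/= leey andbT (le_trans _ (pN t (ltnW tN)))//.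
    by rewrite lee_fin ltW.
have ti0 : 0 <= (t%:R^-1)%:E :> \bar R by rewrite lee_fin invr_ge0 ltW.
rewrite leeNl (le_trans _ (lee_wpmul2l ti0 lnp))//.
rewrite -EFinD -EFinM lee_fin -(ler_pM2l t0) mulVKf ?gt_eqF//.
have := ler_norm (- ln c); rewrite normrN.
by lra.
Qed.

Lemma stopping_time_gtE T (R : realType) (E : nat -> T -> \bar R) (alpha : R)
    (t : nat) :
  [set w | t%:R%:E < stopping_time E alpha w] = no_crossing E alpha^-1 t.
Proof.
apply/seteqP; split => w /=.
  move=> tw k /andP[k0 kt]; rewrite leNgt; apply/negP => kw.
  have : stopping_time E alpha w <= k%:R%:E.
    by apply: ereal_inf_lbound; exists k.
  move=> /(lt_le_trans tw); rewrite lte_fin ltr_nat.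
  by rewrite ltnNge kt.
(* An infimum of values above [t] could still equal [t]; since crossing times are integers, it is at
   least [t.+1], and strictness follows. *)
move=> tw; apply: (@lt_le_trans _ _ t.+1%:R%:E); first by rewrite lte_fin ltr_nat.
apply: le_ereal_inf_tmp => _ [k [k0 kw] <-]; rewrite lee_fin ler_nat.
by rewrite ltnNge; apply/negP => kt; move: kw; rewrite ltNge tw// k0.
Qed.

Lemma no_crossing_lower_bound (R : realType) d (X : measurableType d)
    (P0 P1 : probability X R) (Pr0 Pr1 : probability (path_space X) R)
    (E : nat -> path_space X -> \bar R) (Z : X -> R) (alpha D e : R) :
  is_iid_product P0 Pr0 -> is_iid_product P1 Pr1 ->
  P0.-integrable setT (EFin \o Z) -> \int[P0]_x (Z x)%:E = D%:E ->
  (forall A, measurable A -> P1 A = \int[P0]_(x in A) (expR (- Z x))%:E) ->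
  betting_sequence Pr0 E -> (0 < alpha < 1)%R -> (0 < e)%R ->
  \forall n \near \oo,
    ((1 - alpha) / 2 * expR (- (n%:R * (D + e))))%:E <=
    Pr1 (no_crossing E alpha^-1 n).
Proof.
move=> iid0 iid1 iZ intZ P1E hE /andP[a0 a1] e0.
have /integrableP[/measurable_EFinP mZ _] := iZ.
(* Ville's inequality leaves mass [1 - alpha]; half of it is granted to the tail event [B], so [A]
   without [B] keeps at least [1 - alpha - c = c]. *)
pose c : R := ((1 - alpha) / 2)%R.
have c0 : (0 < c)%R by rewrite divr_gt0// subr_gt0.
have e3 : (0 < e / 3)%R by rewrite divr_gt0.
have := iid_upper_tail iid0 iZ intZ e3 c0.
rewrite (_ : (D + 3 * (e / 3) = D + e)%R); last by field.
apply: filterS => n tail.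
set a := (n%:R * (D + e))%R in tail *.
have mSum : measurable_fun setT (fun w : history X n => \sum_(i < n) Z (w i))%R.
  exact: measurable_sum_coordinates.
pose A := no_crossing E alpha^-1 n.
have mA' : measurable (A : set (history X n)).
  exact: (measurable_no_crossing alpha^-1 (n := n) hE).
have mA : measurable (A : set (path_space X)) := measurable_history_path mA'.
pose B := [set w : path_space X | (a < \sum_(i < n) Z (w i))%R].
have mB : measurable B.
  have mS : measurable_fun setT (fun w : path_space X => (\sum_(i < n) Z (w i))%:E).
    by apply/measurable_EFinP; exact: measurable_fun_history_path mSum.
  by have := emeasurable_fun_o_infty measurableT mS a%:E; rewrite setTI.
have PA : Pr0 (~` A) <= alpha%:E.
  have ia : (0 < alpha^-1)%R by rewrite invr_gt0.
  have := ville n hE (ltW ia).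
  by rewrite muleC lee_pdivrMr// mul1e.
have PAB : c%:E <= Pr0 (A `\` B).
  have -> : A `\` B = ~` (~` A `|` B) by rewrite setCU setCK setDE.
  rewrite probability_setC; last by apply: measurableU => //; exact: measurableC.
  rewrite leeBrDr ?fin_num_measure//; last first.
    by apply: measurableU => //; exact: measurableC.
  apply: (@le_trans _ _ (c%:E + (alpha%:E + c%:E))).
    by rewrite leeD2l// (le_trans (measureU2 _ _ _))// ?leeD//; exact: measurableC.
  by rewrite -!EFinD lee_fin /c; lra.
rewrite -/c -/A.
have f0 x : 0 <= (expR (- Z x))%:E by rewrite lee_fin expR_ge0.
have mf : measurable_fun setT (fun x => (expR (- Z x))%:E).
  apply/measurable_EFinP; apply: measurableT_comp => //.
  exact: measurable_funN.
have [mF _] := ge0_integral_prod n iid0 (fun=> mf) (fun=> f0).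
rewrite [leRHS](iid_density iid0 iid1 mf f0 P1E mA').
have mAB : measurable (A `\` B) by exact: measurableD.
apply: (@le_trans _ _ (\int[Pr0]_(w in A `\` B) \prod_(i < n) (expR (- Z (w i)))%:E)).
  (* Off [B] the sum of the [Z (w i)] is at most [a], so the density of [Pr1] on F_n is at least
     [expR (- a)] there. *)
  rewrite mulrC EFinM (le_trans (lee_wpmul2l _ PAB)) ?lee_fin ?expR_ge0//.
  rewrite -integral_cst//; apply: ge0_le_integral => //.
  - by move=> w _; rewrite lee_fin expR_ge0.
  - by apply: measurable_funTS; exact: measurable_fun_history_path mF.
  move=> w [_ /negP]; rewrite -leNgt => wa.
  by rewrite prodEFin lee_fin -expR_sum ler_expR sumrN lerN2.
apply: ge0_subset_integral => //.
  by apply: measurable_funTS; exact: measurable_fun_history_path mF.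
by move=> w _; exact: prode_ge0.
Qed.

Theorem proposition4p15 (R : realType) (d : measure_display)
    (X : measurableType d) (P0 P1 : probability X R)
    (Pr0 Pr1 : probability (path_space X) R)
    (hPr0 : is_iid_product P0 Pr0) (hPr1 : is_iid_product P1 Pr1)
    (hac : P1 `<< P0) (hKL10 : KL P1 P0 < +oo) (hKL01 : KL P0 P1 < +oo)
    (E : nat -> path_space X -> \bar R) (hE : betting_sequence Pr0 E)
    (alpha : R) (halpha : (0 < alpha < 1)%R) :
  decay_rate (gamma_bar Pr1 E alpha) <= KL P0 P1 /\
  decay_rate (gamma_err Pr1 E alpha) <= KL P0 P1.
Proof.
have [Z [iZ KLE P1E]] := KL_log_density hac hKL01.
have [D intZ] : exists D, \int[P0]_x (Z x)%:E = D%:E.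
  exists (fine (\int[P0]_x (Z x)%:E)); rewrite fineK//.
  exact: integrable_fin_num.
have c0 : (0 < (1 - alpha) / 2)%R.
  by move/andP: halpha => [_ a1]; rewrite divr_gt0// subr_gt0.
have lb e : (0 < e)%R -> _ :=
  no_crossing_lower_bound hPr0 hPr1 iZ intZ P1E hE halpha.
rewrite KLE intZ; split; apply: (decay_rate_le c0) => e /lb.
  by apply: filterS => n; rewrite /gamma_bar stopping_time_gtE.
(* For [gamma_err] it suffices that paths without a crossing up to [n] have wealth at most
   [alpha^-1] at time [n] itself. Taking [n] positive makes [n] one of the indices constrained by
   [no_crossing]. *)
move=> lbe; near=> n.
have n0 : (0 < n)%N by near: n; exists 1%N.
apply: (@le_trans _ _ (Pr1 (no_crossing E alpha^-1 n))); first by near: n.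
have mnc : measurable (no_crossing E alpha^-1 n : set (path_space X)).
  exact: measurable_history_path (measurable_no_crossing alpha^-1 (n := n) hE).
apply: le_measure; rewrite ?inE//.
  have mW := measurable_fun_history_path (measurable_wealth (n := n) hE).
  have := emeasurable_fun_infty_c measurableT mW alpha^-1%:E.
  by rewrite setTI.
by move=> w; apply; rewrite n0 leqnn.
Unshelve. all: by end_near. Qed.
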